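(* Let $\mathbf{P}\in\mathbb{R}^{N\times N}$ be a diagonal matrix with positive diagonal entries $p_{ii}$, let $\mathbf{U}\in\mathbb{R}^{N\times s}$ ($N>s$) have orthonormal columns, and let $\mathbf{Y}(\mathbf{P})=\mathbf{U}^\top\mathbf{P}\mathbf{U}$. Let $\bar{\mathbf{Y}}(\mathbf{P})=\frac1\nu\sum_{t=1}^\nu\hat{\mathbf{Y}}_t(\mathbf{P})$ be the $s\times s$ matrix average of the $\nu$ i.i.d. sketches (defined in the context) for the same parameters $\mathbf{P}$, and let $0<\epsilon<1$. Then $$\mathbb{P}\bigl(\|\bar{\mathbf{Y}}(\mathbf{P})-\mathbf{Y}(\mathbf{P})\|\ge\epsilon\bigr)\le2s\exp\left(-\frac{\epsilon^2/2}{\|\mathbf{V}_{\bar{\mathbf{Y}}}\|+L\epsilon/3}\right),$$ where $$\|\mathbf{V}_{\bar{\mathbf{Y}}}\|=\frac1\nu\Bigl\|\sum_{i=1}^Np_{ii}^2\Bigl(\frac1{\eta_i}-1\Bigr)\ell_i(\mathbf{U})\,\mathbf{u}_{(i)}^\top\mathbf{u}_{(i)}\Bigr\|\quad\text{and}\quad L=\frac sc\|\mathbf{P}\|_\infty.$$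
   Context: $\mathbf{u}_{(i)}$ is the $i$-th row of $\mathbf{U}$ (a $1\times s$ vector), $\ell_i(\mathbf{U})=\|\mathbf{u}_{(i)}\|^2$ its leverage score, $\xi_i(\mathbf{U})=s^{-1}\ell_i(\mathbf{U})$, and for a positive integer $c$, $\eta_i=\min\{1,c\,\xi_i(\mathbf{U})\}>0$. For $t=1,\dots,\nu$ and $i=1,\dots,N$, $\gamma_i^{(t)}$ are independent Bernoulli variables with $\mathbb{P}(\gamma_i^{(t)}=1)=\eta_i$, $\mathbf{S}_t=\mathrm{diag}\bigl(\gamma_1^{(t)}/\sqrt{\eta_1},\dots,\gamma_N^{(t)}/\sqrt{\eta_N}\bigr)$, and $\hat{\mathbf{Y}}_t(\mathbf{P})=\mathbf{U}^\top\mathbf{P}^{1/2}\mathbf{S}_t^\top\mathbf{S}_t\mathbf{P}^{1/2}\mathbf{U}$. $\|\cdot\|$ is the spectral norm, and $\|\mathbf{P}\|_\infty=\max_ip_{ii}$. *)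

(* Defs.v *)
From HB Require Import structures.
From mathcomp Require Import all_boot all_order all_algebra.
From mathcomp Require Import all_classical all_reals all_analysis.

Set Implicit Arguments.
Unset Strict Implicit.
Unset Printing Implicit Defensive.

Import Order.TTheory GRing.Theory Num.Theory.
Import numFieldNormedType.Exports.

Local Open Scope classical_set_scope.
Local Open Scope ring_scope.

(* The canonical norm on matrices, `|A|, is the entrywise maximum; the
   Euclidean norm and the induced operator norm have to be introduced. *)
Definition l2norm (R : realType) (n : nat) (v : 'cV[R]_n) : R :=
  Num.sqrt (\sum_(i < n) v i 0 ^+ 2).

Definition specnorm (R : realType) (m n : nat) (A : 'M[R]_(m, n)) : R :=
  sup [set l2norm (A *m x) | x in [set x : 'cV[R]_n | l2norm x <= 1]].

(* Used only for matrices with positive diagonal, so the default value 0 is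
   never larger than a diagonal entry. *)
Definition max_diag (R : realType) (N : nat) (P : 'M[R]_N) : R :=
  \big[Num.max/0]_(i < N) P i i.

(* The square root of P, for P diagonal with nonnegative diagonal. *)
Definition diag_sqrt (R : realType) (N : nat) (P : 'M[R]_N) : 'M[R]_N :=
  diag_mx (\row_(i < N) Num.sqrt (P i i)).

(* Joint independence of a finite family of random variables: the product rule
   over every subfamily. *)
Definition mutually_independent (d d' : measure_display)
    (T : measurableType d) (T' : measurableType d') (R : realType)
    (Pr : probability T R) (I : finType) (X : I -> {RV Pr >-> T'}) : Prop :=
  forall (J : {set I}) (B : I -> set T'), (forall i, measurable (B i)) ->
    Pr (\bigcap_(i in [set` J]) (X i @^-1` B i)) =
    (\prod_(i in J) Pr (X i @^-1` B i))%E.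

Section Sketches.
Variables (R : realType) (N s : nat).
Implicit Types (U : 'M[R]_(N, s)) (P : 'M[R]_N) (c : nat).

Definition leverage U (i : 'I_N) : R := l2norm (row i U)^T ^+ 2.

Definition lev_prob U (i : 'I_N) : R := s%:R^-1 * leverage U i.

Definition keep_prob c U (i : 'I_N) : R := Num.min 1 (c%:R * lev_prob U i).

Definition Ymx U P : 'M[R]_s := U^T *m P *m U.

(* g i is the outcome (0 or 1) of the i-th Bernoulli trial. *)
Definition sampling_mx c U (g : 'I_N -> bool) : 'M[R]_N :=
  diag_mx (\row_(i < N) ((g i)%:R / Num.sqrt (keep_prob c U i))).

Definition sketch c U P (g : 'I_N -> bool) : 'M[R]_s :=
  U^T *m diag_sqrt P *m (sampling_mx c U g)^T *m sampling_mx c U g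
    *m diag_sqrt P *m U.

Definition avg_sketch c U P (nu : nat) (g : 'I_nu -> 'I_N -> bool) : 'M[R]_s :=
  nu%:R^-1 *: \sum_(t < nu) sketch c U P (g t).

Definition varnorm c U P (nu : nat) : R :=
  nu%:R^-1 * specnorm (\sum_(i < N)
    (P i i ^+ 2 * ((keep_prob c U i)^-1 - 1) * leverage U i)
      *: ((row i U)^T *m row i U)).

Definition Lconst c P : R := s%:R / c%:R * max_diag P.

End Sketches.

Arguments Lconst {R N} s c P.

(* Main.v *)
Require Import Defs.
From HB Require Import structures.
From mathcomp Require Import all_boot all_order all_algebra.
From mathcomp Require Import all_classical all_reals all_analysis.
From mathcomp Require Import ring lra.

Set Implicit Arguments.
Unset Strict Implicit.
Unset Printing Implicit Defensive.

Import Order.TTheory GRing.Theory Num.Theory.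
Import numFieldNormedType.Exports.

Local Open Scope classical_set_scope.
Local Open Scope ring_scope.

(* The deviation of the averaged sketch is a sum of independent terms x_k A_k,
   with x_k a centered two-valued random variable and A_k = u^T u fixed, so that
   A_k^2 = l_k A_k.  Since x_k A_k commutes with its second moment, the variance
   of the sum can be put into the exponent one term at a time: for
     z_k = theta x_k - g(theta) E[x_k^2] l_k
   the scalar Bernstein inequality gives E exp(z_k l_k) <= 1, and the
   Golden-Thompson inequality
     E tr exp(D + z_k A_k) <= E tr(exp(D) exp(z_k A_k)) <= tr exp(D)
   (D independent of x_k) yields E tr exp(sum_k z_k A_k) <= s by induction.
   Thus Golden-Thompson suffices, and Lieb's concavity theorem is not needed.
   If the quadratic form of the deviation is at least a at a unit vector v, that
   of the exponent is at least theta a - g(theta) |V| at v, and Markov's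
   inequality concludes.

   The matrix exponential is replaced by (1 + H/n)^n for n a power of 2, where
   Golden-Thompson is tr (AB)^n <= tr(A^n B^n) for symmetric A and B, up to an
   error O(1/n) from 1 + (D+B)/n = (1 + D/n)(1 + B/n) + O(1/n^2). *)

(** * Trace inequalities for powers and quadratic forms of symmetric matrices *)

Section TraceInequalities.
Variables (R : realFieldType) (s : nat).
Implicit Types A B M : 'M[R]_s.

Lemma mxtrace_tr_mul_ge0 m n (A : 'M[R]_(m, n)) : 0 <= \tr (A^T *m A).
Proof.
apply: sumr_ge0 => i _; rewrite mxE; apply: sumr_ge0 => j _.
by rewrite mxE -expr2 sqr_ge0.
Qed.

Lemma mxtrace_mul_le A B :
  \tr (A^T *m B) <= (\tr (A^T *m A) + \tr (B^T *m B)) / 2.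
Proof.
have := mxtrace_tr_mul_ge0 (A - B).
rewrite [(A - B)^T]linearB /= mulmxBl !mulmxBr !(raddfB (@mxtrace R s)) /=
  -[\tr (B^T *m A)]mxtrace_tr.
by rewrite trmx_mul trmxK; lra.
Qed.

Lemma trmxX A n : (A ^+ n)^T = A^T ^+ n.
Proof.
elim: n => [|n IHn]; first by rewrite !expr0 trmx1.
by rewrite exprS exprSr -!mulmxE trmx_mul IHn.
Qed.

Lemma mxtrace_expC A B n : \tr ((A * B) ^+ n) = \tr ((B * A) ^+ n).
Proof.
case: n => [|n]; first by rewrite !expr0.
have E : (A * B) ^+ n * A = A * (B * A) ^+ n.
  elim: n => [|n IHn]; first by rewrite !expr0 mulr1 mul1r.
  by rewrite exprS -mulrA IHn exprS !mulrA.
by rewrite exprSr mulrA E -!mulmxE mxtrace_mulC !mulmxE mulrA -exprS.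
Qed.

(* The induction step of each inequality uses both of them. *)
Lemma mxtrace_exp2_le j :
  (forall A B, A^T = A -> B^T = B ->
     \tr ((A * B) ^+ (2 ^ j)) <= \tr (A ^+ (2 ^ j) * B ^+ (2 ^ j))) /\
  (forall M, \tr (M ^+ (2 ^ j.+1)) <= \tr ((M^T * M) ^+ (2 ^ j))).
Proof.
elim: j => [|j [IH1 IH2]].
  split=> [A B _ _|M]; first by rewrite !expr1.
  rewrite expr1 expr2 -[in X in \tr (X * _)](trmxK M) -!mulmxE.
  apply: le_trans (mxtrace_mul_le _ _) _.
  by rewrite trmxK [\tr (M *m _)]mxtrace_mulC; lra.
have P1 A B : A^T = A -> B^T = B ->
    \tr ((A * B) ^+ (2 ^ j.+1)) <= \tr (A ^+ (2 ^ j.+1) * B ^+ (2 ^ j.+1)).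
  move=> sA sB; apply: le_trans (IH2 _) _.
  (* With [M = A * B], the product [M^T * M] is [B * A * A * B], which cyclicity of the trace turns
     into [A ^+ 2 * B ^+ 2]; the first inequality at level [j] then applies to the squares. *)
  rewrite -[in (_)^T]mulmxE trmx_mul sA sB mulmxE -mulrA mxtrace_expC.
  have -> : A * (A * B) * B = A ^+ 2 * B ^+ 2 by rewrite !expr2 !mulrA.
  apply: le_trans (IH1 _ _ _ _) _; rewrite ?trmxX ?sA ?sB //.
  by rewrite -!exprM -!expnS.
split=> // M; rewrite expnS exprM; apply: le_trans (IH2 _) _.
(* For [M ^+ 2], cyclicity produces the product of the symmetric matrices [M^T * M] and [M * M^T].
   Their powers have the same trace, so [mxtrace_mul_le] merges the two into one. *)
rewrite expr2 -[in (_)^T]mulmxE trmx_mul mulmxE -mulrA mxtrace_expC.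
rewrite !mulrA -[M^T * M * M * M^T]mulrA.
apply: le_trans (IH1 _ _ _ _) _; rewrite -?mulmxE ?trmx_mul ?trmxK //.
set X := (M^T *m M) ^+ _; set Y := (M *m M^T) ^+ _.
have tX : X^T = X by rewrite trmxX trmx_mul trmxK.
have tY : Y^T = Y by rewrite trmxX trmx_mul trmxK.
rewrite -[in X in X <= _]tX; apply: le_trans (mxtrace_mul_le _ _) _.
rewrite tX tY /X /Y !mulmxE -!exprD addnn -mul2n -expnS.
by rewrite (mxtrace_expC M) //; lra.
Qed.

Lemma mxtrace_mul_exp_le A B m : A^T = A -> B^T = B ->
  \tr ((A * B) ^+ (2 ^ m)) <= \tr (A ^+ (2 ^ m) * B ^+ (2 ^ m)).
Proof. by case: (mxtrace_exp2_le m) => + _; apply. Qed.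

(** Cauchy-Schwarz for a unit [v]: the part of [w] orthogonal to [v] has nonnegative squared
    norm. *)
Lemma sqr_dot_le (v w : 'cV[R]_s) :
  v^T *m v = 1%:M -> (v^T *m w) 0 0 ^+ 2 <= (w^T *m w) 0 0.
Proof.
move=> v1; have e : v^T *m w = ((v^T *m w) 0 0)%:M by rewrite -mx11_scalar.
have e' : w^T *m v = ((v^T *m w) 0 0)%:M.
  by rewrite -[LHS]trmxK trmx_mul trmxK e tr_scalar_mx !mxE eqxx.
move: e e' (mxtrace_tr_mul_ge0 (w - (v^T *m w) 0 0 *: v)).
move: (_ 0 0) => q e e'; rewrite /mxtrace big_ord1.
rewrite [(w - _)^T]linearB /= linearZ /= mulmxBl !mulmxBr -!scalemxAl
  -!scalemxAr.
by rewrite e e' v1 !mxE !eqxx /=; lra.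
Qed.

(** Jensen's inequality by repeated squaring: for symmetric [N], the square of the form of [N] at
    [v] is at most the squared norm of [N *m v], which is the form of [N ^+ 2] at [v]. *)
Lemma quadform_exp2_ge M m (v : 'cV[R]_s) (h : R) : M^T = M -> 0 <= h ->
  v^T *m v = 1%:M -> h <= (v^T *m M *m v) 0 0 ->
  h ^+ (2 ^ m) <= (v^T *m (M ^+ (2 ^ m)) *m v) 0 0.
Proof.
move=> sM h0 v1 hv; elim: m => [|m IHm]; first by rewrite !expr1.
rewrite expnSr !exprM; set h' := h ^+ (2 ^ m) in IHm *.
have h'0 : 0 <= h' by rewrite exprn_ge0.
set N := M ^+ (2 ^ m) in IHm *; have sN : N^T = N by rewrite trmxX sM.
apply: (@le_trans _ _ ((v^T *m N *m v) 0 0 ^+ 2)).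
  by rewrite lerXn2r ?nnegrE // (le_trans h'0).
have := sqr_dot_le (N *m v) v1.
by rewrite trmx_mul sN -[N ^+ 2]/(N *m N) !mulmxA.
Qed.

(** With [Q] the projection on [v], the difference is the trace of [M *m (1%:M - Q) *m M]. Writing
    the matrix as a square encodes its positivity. *)
Lemma quadform_le_mxtrace M (v : 'cV[R]_s) : M^T = M -> v^T *m v = 1%:M ->
  (v^T *m (M *m M) *m v) 0 0 <= \tr (M *m M).
Proof.
move=> sM v1; set Q := v *m v^T.
have sQ : Q^T = Q by rewrite trmx_mul trmxK.
have QQ : Q *m Q = Q by rewrite mulmxA -[_ *m v^T *m v]mulmxA v1 mulmx1.
have := mxtrace_tr_mul_ge0 (M *m (1%:M - Q)).
have idem : (1%:M - Q) *m (1%:M - Q) = 1%:M - Q.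
  by rewrite mulmxBr mulmx1 mulmxBl mul1mx QQ subrr subr0.
rewrite mxtrace_mulC trmx_mul [(1%:M - Q)^T]linearB /= trmx1 sQ sM -(mulmxA M).
rewrite (mulmxA (1%:M - Q)) idem mulmxBl mul1mx mulmxBr (raddfB (@mxtrace R s))
  /= subr_ge0.
by rewrite mxtrace_mulC /Q -!mulmxA mxtrace_mulC /mxtrace big_ord1 !mulmxA.
Qed.

End TraceInequalities.

(** * A submultiplicative matrix bound *)

Section RowSumBound.
Variables (R : realType) (s : nat).
Implicit Types (A B D : 'M[R]_s) (a b r : R).

(** For [r] nonnegative this bounds by [r] the operator norm induced by the maximum norm on
    vectors. *)
Definition row_sum_le r A := forall i, \sum_j `|A i j| <= r.

Lemma row_sum_le_exists A : exists2 a, 0 <= a & row_sum_le a A.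
Proof.
exists (\sum_i \sum_j `|A i j|); first by do 2!apply: sumr_ge0 => ? _.
move=> i; rewrite [leRHS](bigD1 i) //= lerDl; do 2!apply: sumr_ge0 => ? _;
  exact: normr_ge0.
Qed.

Lemma row_sum_le1 : row_sum_le 1 (1 : 'M[R]_s).
Proof.
move=> i; rewrite (bigD1 i) //= mxE eqxx normr1 big1 ?addr0 // => j ji.
by rewrite mxE eq_sym (negPf ji) normr0.
Qed.

Lemma row_sum_leD a b A B :
  row_sum_le a A -> row_sum_le b B -> row_sum_le (a + b) (A + B).
Proof.
move=> hA hB i; apply: le_trans (lerD (hA i) (hB i)).
by rewrite -big_split; apply: ler_sum => j _; rewrite mxE ler_normD.
Qed.

Lemma row_sum_leZ a A x : row_sum_le a A -> row_sum_le (`|x| * a) (x *: A).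
Proof.
move=> hA i; apply: le_trans (ler_wpM2l (normr_ge0 x) (hA i)).
by rewrite mulr_sumr; apply: ler_sum => j _; rewrite mxE normrM.
Qed.

Lemma row_sum_leM a b A B : 0 <= b ->
  row_sum_le a A -> row_sum_le b B -> row_sum_le (a * b) (A * B).
Proof.
move=> b0 hA hB i; apply: le_trans (ler_wpM2r b0 (hA i)).
rewrite mulr_suml; apply: (@le_trans _ _ (\sum_j \sum_k `|A i k| * `|B k j|)).
  apply: ler_sum => j _; rewrite mxE; apply: le_trans (ler_norm_sum _ _ _) _.
  by apply: ler_sum => k _; rewrite normrM.
rewrite exchange_big /=; apply: ler_sum => k _.
by rewrite -mulr_sumr ler_wpM2l.
Qed.

Lemma row_sum_leX r A n : 0 <= r -> row_sum_le r A -> row_sum_le (r ^+ n) (A ^+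
  n).
Proof.
move=> r0 hA; elim: n => [|n IHn]; first exact: row_sum_le1.
by rewrite !exprSr; apply: row_sum_leM.
Qed.

(** Telescoping: each of the [n] replacements of a factor [B] by [A] costs [e]. Since [1 <= r], the
    exponent [n] can stand for [n - 1]. *)
Lemma row_sum_leBX r e A B n : 1 <= r -> 0 <= e ->
  row_sum_le r A -> row_sum_le r B -> row_sum_le e (A - B) ->
  row_sum_le (n%:R * r ^+ n * e) (A ^+ n - B ^+ n).
Proof.
move=> r1 e0 hA hB hAB; have r0 : 0 <= r by apply: le_trans r1.
elim: n => [|n IHn] i.
  by rewrite !expr0 subrr big1 ?mul0r // => j _; rewrite mxE normr0.
have -> : A ^+ n.+1 - B ^+ n.+1 = A ^+ n * (A - B) + (A ^+ n - B ^+ n) * B.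
  by rewrite mulrBr mulrBl -!exprSr addrA subrK.
apply: le_trans (_ : r ^+ n * e + n%:R * r ^+ n * e * r <= _).
  apply: (row_sum_leD (a := r ^+ n * e)) => //.
    exact/row_sum_leM/hAB/row_sum_leX.
  exact: row_sum_leM.
rewrite -natr1 exprSr !mulrDl mul1r addrC lerD //;
  first by rewrite mulrAC -!mulrA.
by rewrite -mulrA ler_wpM2l ?exprn_ge0 // ler_peMl.
Qed.

Lemma mxtrace_le_row_sum r A : row_sum_le r A -> `|\tr A| <= s%:R * r.
Proof.
move=> hA; apply: le_trans (ler_norm_sum _ _ _) _.
rewrite -[s in s%:R]card_ord -sumr_const mulr_suml; apply: ler_sum => i _.
rewrite mul1r; apply: le_trans (hA i); rewrite (bigD1 i) //= lerDl.
by apply: sumr_ge0 => j _.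
Qed.

End RowSumBound.

(** * Euler powers and the Trotter error *)

Section Euler.
Variable R : realType.

Lemma expn_euler_le (x : R) n : (0 < n)%N -> 0 <= 1 + x / n%:R ->
  (1 + x / n%:R) ^+ n <= expR x.
Proof.
move=> n0 h; apply: (@le_trans _ _ (expR (x / n%:R) ^+ n)).
  by rewrite lerXn2r ?nnegrE ?expR_ge0 // expR_ge1Dx.
by rewrite -expRM_natl mulrC divfK ?pnatr_eq0 ?gtn_eqF.
Qed.

Definition euler s n (H : 'M[R]_s) : 'M[R]_s := (1 + n%:R^-1 *: H) ^+ n.

(** The two bases differ by [D * B] over [n ^ 2], and their powers are bounded by [expR (a + b)]
    uniformly in [n]; [n] replacements leave an error of order 1/n. *)
Lemma trotter_mxtrace s (D B : 'M[R]_s) : exists2 C, 0 <= C &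
  forall n, (0 < n)%N ->
    \tr (euler n (D + B))
      <= \tr (((1 + n%:R^-1 *: D) * (1 + n%:R^-1 *: B)) ^+ n) + C / n%:R.
Proof.
have [a a0 ha] := row_sum_le_exists D; have [b b0 hb] := row_sum_le_exists B.
exists (s%:R * (expR (a + b) * (a * b))); first by rewrite !mulr_ge0 ?expR_ge0.
move=> n n0; set t := n%:R^-1; have t0 : 0 < t by rewrite invr_gt0 ltr0n.
pose r := (1 + t * a) * (1 + t * b).
have hZ c (X : 'M[R]_s) : row_sum_le c X -> row_sum_le (1 + t * c) (1 + t *: X).
  move=> hX; apply: row_sum_leD; first exact: row_sum_le1.
  by rewrite -{1}(gtr0_norm t0); apply: row_sum_leZ.
have ta0 : 0 <= t * a by rewrite mulr_ge0 // ltW.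
have tb0 : 0 <= t * b by rewrite mulr_ge0 // ltW.
have hX : row_sum_le r (1 + t *: (D + B)).
  move=> i; apply: le_trans (_ : 1 + t * (a + b) <= _).
    exact: (hZ _ _ (row_sum_leD ha hb) i).
  by rewrite /r; nra.
have hY : row_sum_le r ((1 + t *: D) * (1 + t *: B)).
  by apply: row_sum_leM; rewrite ?addr_ge0 //; apply: hZ.
have hXY : row_sum_le (t ^+ 2 * (a * b))
    (1 + t *: (D + B) - (1 + t *: D) * (1 + t *: B)).
  have -> : 1 + t *: (D + B) - (1 + t *: D) * (1 + t *: B) = - t ^+ 2 *: (D *
    B).
    rewrite mulrDl mul1r mulrDr mulr1 -!mulmxE -scalemxAl -scalemxAr scalerA.
    rewrite scalerDr [t *: D + _]addrC !addrA opprD addrA subrr sub0r.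
    by rewrite scaleNr.
  have := row_sum_leZ (- t ^+ 2) (row_sum_leM b0 ha hb).
  by rewrite normrN ger0_norm // sqr_ge0.
have r1 : 1 <= r by rewrite /r; nra.
have e0 : 0 <= t ^+ 2 * (a * b) by rewrite !mulr_ge0 // ltW.
have := mxtrace_le_row_sum (row_sum_leBX n r1 e0 hX hY hXY).
rewrite (raddfB (@mxtrace R s)) /= => /(le_trans (ler_norm _)).
rewrite lerBlDl => /le_trans; apply; rewrite lerD2l -[leRHS]mulrA ler_wpM2l //.
have rn : r ^+ n <= expR (a + b).
  by rewrite exprMn expRD ler_pM ?exprn_ge0 ?addr_ge0 // /t mulrC expn_euler_le
    ?addr_ge0 // mulrC.
apply: le_trans (_ : n%:R * expR (a + b) * (t ^+ 2 * (a * b)) <= _).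
  by rewrite ler_wpM2r // ler_wpM2l.
have nt : n%:R * t = 1 by rewrite mulfV // pnatr_eq0 gtn_eqF.
have -> : expR (a + b) * (a * b) / n%:R = n%:R * t * (expR (a + b) * (a * b) *
  t).
  by rewrite nt mul1r.
rewrite le_eqVlt; apply/orP; left; apply/eqP; ring.
Qed.

End Euler.

(** * Golden-Thompson for a single increment *)

Section Increment.
Variables (R : realType) (s : nat).
Implicit Types (A D : 'M[R]_s).

(** [A] is [l] times a projection, so powers of [1 + y *: A] only involve the eigenvalues 1 and
    [1 + y * l]. *)
Lemma expn_1DZ_proj A l y n : l != 0 -> A * A = l *: A ->
  (1 + y *: A) ^+ n = 1 + (((1 + y * l) ^+ n - 1) / l) *: A.
Proof.
move=> l0 AA; elim: n => [|n IHn].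
  by rewrite !expr0 subrr mul0r scale0r addr0.
rewrite exprSr IHn mulrDl mul1r mulrDr mulr1 -addrA; congr (_ + _).
rewrite -!mulmxE -scalemxAl -scalemxAr !mulmxE AA !scalerA -!scalerDl.
by congr (_ *: _); rewrite exprSr; field.
Qed.

(** As [0 < m], the Euler power is the square of a symmetric [X], and [l] times the trace is that of
    [(A *m X)^T *m (A *m X)]. *)
Lemma mxtrace_euler_proj_ge0 A D l m : 0 < l -> A^T = A -> A * A = l *: A ->
  D^T = D -> (0 < m)%N -> 0 <= \tr (euler (2 ^ m) D * A).
Proof.
move=> l0 sA AA sD; case: m => // m _; set n := (2 ^ m)%N.
set X := (1 + (2 ^ m.+1)%:R^-1 *: D) ^+ n.
have sX : X^T = X by rewrite trmxX linearD /= linearZ /= sD trmx1.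
have -> : euler (2 ^ m.+1) D = X * X by rewrite /euler /X expnS mul2n -addnn
  exprD.
have := mxtrace_tr_mul_ge0 (A *m X).
rewrite trmx_mul sA sX -mulmxA (mulmxA A A X) [A *m A]AA -scalemxAl -scalemxAr.
by rewrite mxtraceZ pmulr_rge0 // -!mulmxE mulmxA mxtrace_mulC mulmxA.
Qed.

(* Golden-Thompson for an increment with a one-point spectrum away from 0,
   with [euler n] in place of the exponential. *)
Lemma golden_thompson_proj A D l x : 0 < l -> A^T = A -> A * A = l *: A ->
  D^T = D -> exists2 C, 0 <= C &
  forall m, (0 < m)%N -> C <= (2 ^ m)%:R ->
    \tr (euler (2 ^ m) (D + x *: A)) <= \tr (euler (2 ^ m) D)
      + (expR (x * l) - 1) / l * \tr (euler (2 ^ m) D * A) + C / (2 ^ m)%:R.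
Proof.
move=> l0 sA AA sD; have [C C0 hC] := trotter_mxtrace D (x *: A).
exists (C + `|x * l|) => [|m m0]; first by rewrite addr_ge0.
have := hC (2 ^ m)%N; have := mxtrace_euler_proj_ge0 l0 sA AA sD m0.
rewrite expn_gt0 /=; set n := (2 ^ m)%N => tr0 /(_ isT) h Cn.
have n0 : (0 < n)%N by rewrite expn_gt0.
have nR : 0 < n%:R :> R by rewrite ltr0n.
apply: le_trans h _; apply: lerD; last first.
  by rewrite ler_pM2r ?invr_gt0 // lerDl.
have sE (H : 'M[R]_s) : H^T = H -> (1 + n%:R^-1 *: H)^T = 1 + n%:R^-1 *: H.
  by move=> sH; rewrite linearD /= linearZ /= sH trmx1.
apply: le_trans (mxtrace_mul_exp_le _ _ _) _; try apply: sE => //.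
  by rewrite linearZ /= sA.
rewrite -/n -/(euler n D) scalerA (expn_1DZ_proj _ _ _ AA) ?gt_eqF //.
rewrite mulrDr mulr1 mxtraceD lerD2l -mulmxE -scalemxAr mxtraceZ.
apply: ler_wpM2r => //; apply: ler_wpM2r; first by rewrite invr_ge0 ltW.
rewrite lerD2r; have -> : n%:R^-1 * x * l = x * l / n%:R by rewrite mulrC mulrA
  mulrC mulrA.
apply: expn_euler_le => //.
have : `|x * l| <= n%:R by apply: le_trans Cn; rewrite lerDr.
rewrite ler_norml => /andP[h _].
by rewrite -lerBlDl sub0r lerNl -mulNr ler_pdivrMr // mul1r lerNl.
Qed.

End Increment.

(** * Expectations under a product of two-point laws *)

Section Product.
Variables (R : realType) (I : finType) (w : I -> bool -> R).
Hypothesis w_ge0 : forall k b, 0 <= w k b.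

Definition flip (k : I) (g : {ffun I -> bool}) : {ffun I -> bool} :=
  [ffun i => g i (+) (i == k)].

Lemma flipK k : involutive (flip k).
Proof. by move=> g; apply/ffunP => i; rewrite !ffunE -addbA addbb addbF. Qed.

Definition prod_weight (g : {ffun I -> bool}) : R := \prod_k w k (g k).

Lemma prod_weight_ge0 g : 0 <= prod_weight g.
Proof. exact: prodr_ge0. Qed.

Lemma sum_prod_weight : (forall k, \sum_b w k b = 1) -> \sum_g prod_weight g =
  1.
Proof. by move=> w1; rewrite -bigA_distr_bigA big1. Qed.

(** Conditioning on the coordinates other than [k]: pairing [g] with [flip k g] isolates the mean of
    [y] under [w k], multiplied by nonnegative factors. *)
Lemma sum_prod_weight_le0 k (c : {ffun I -> bool} -> R) (y : bool -> R) :
  (forall g, 0 <= c g) -> (forall g, c (flip k g) = c g) ->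
  \sum_b w k b * y b <= 0 ->
  \sum_g prod_weight g * (c g * y (g k)) <= 0.
Proof.
move=> c0 cflip wy; set S := \sum_g _.
suff : S + S <= 0 by lra.
rewrite {2}/S (reindex_inj (inv_inj (flipK k))) -big_split.
apply: sumr_le0 => g _ /=;
  rewrite cflip /prod_weight [X in X * _ + _](bigD1 k) //=.
rewrite [X in _ + X * _](bigD1 k) //=;
  have -> : flip k g k = ~~ g k by rewrite ffunE eqxx addbT.
rewrite [\prod_(i | _) w i (flip k g i)](eq_bigr (fun i => w i (g i)));
  last first.
  by move=> i ik; rewrite ffunE (negPf ik) addbF.
set p := \prod_(i | _) _; have p0 : 0 <= p by apply: prodr_ge0.
rewrite (_ : _ + _ = p * c g * (\sum_b w k b * y b)).
  by rewrite mulr_ge0_le0 // mulr_ge0.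
by rewrite big_bool /=; case: (g k) => /=; ring.
Qed.

Variables (s : nat) (z : I -> bool -> R) (A : I -> 'M[R]_s) (l : I -> R).
Hypothesis w_sum1 : forall k, \sum_b w k b = 1.
Hypothesis l_gt0 : forall k, 0 < l k.
Hypothesis A_sym : forall k, (A k)^T = A k.
Hypothesis A_sqr : forall k, A k * A k = l k *: A k.
Hypothesis wz : forall k, \sum_b w k b * expR (z k b * l k) <= 1.

Lemma mean_mxtrace_euler_le : exists2 C, 0 <= C &
  forall m, (0 < m)%N -> C <= (2 ^ m)%:R ->
    \sum_g prod_weight g * \tr (euler (2 ^ m) (\sum_k z k (g k) *: A k))
      <= s%:R + C / (2 ^ m)%:R.
Proof.
(* The induction adds one index at a time; uniqueness keeps [k] out of the remaining list, so that
   [D g] does not depend on [g k]. *)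
have : uniq (index_enum I) by apply: index_enum_uniq.
elim: (index_enum I) => [_|k r IHr /= /andP[kr ur]].
  exists 0 => // m _ _;
    under eq_bigr do rewrite big_nil /euler scaler0 addr0 expr1n mxtrace1.
  by rewrite -mulr_suml sum_prod_weight // mul1r mul0r addr0.
have {IHr ur} [C C0 hC] := IHr ur.
pose D (g : {ffun I -> bool}) := \sum_(i <- r) z i (g i) *: A i.
have sD g : (D g)^T = D g.
  by rewrite linear_sum; apply: eq_bigr => i _; rewrite linearZ /= A_sym.
have Dflip g : D (flip k g) = D g.
  apply: eq_big_seq => i ir; rewrite ffunE.
  by case: eqP ir kr => [->->//|]; rewrite addbF.
(* The Golden-Thompson error depends on the outcome [g]. There are finitely many outcomes, so the
   sum of these constants serves for all of them. *)
have /choice[E hE] : forall g : {ffun I -> bool}, exists C, 0 <= C /\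
  forall m, (0 < m)%N -> C <= (2 ^ m)%:R ->
    \tr (euler (2 ^ m) (D g + z k (g k) *: A k)) <= \tr (euler (2 ^ m) (D g))
      + (expR (z k (g k) * l k) - 1) / l k * \tr (euler (2 ^ m) (D g) * A k)
      + C / (2 ^ m)%:R.
  move=> g; have [C' ? ?] := golden_thompson_proj (z k (g k)) (l_gt0 k) (A_sym
    k) (A_sqr k) (sD g).
  by exists C'.
have E0 g : 0 <= E g by case: (hE g).
have Ele g : E g <= \sum_g E g by rewrite (bigD1 g) //= lerDl sumr_ge0.
exists (C + \sum_g E g) => [|m m0 Cm]; first by rewrite addr_ge0 // sumr_ge0.
set n := (2 ^ m)%N in Cm *; have n0 : 0 < n%:R :> R by rewrite ltr0n expn_gt0.
have S0 : 0 <= \sum_g E g by rewrite sumr_ge0.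
have {hC} hC : \sum_g prod_weight g * \tr (euler n (D g)) <= s%:R + C / n%:R.
  by apply: hC => //; apply: le_trans Cm; rewrite lerDl.
pose c g := (l k)^-1 * \tr (euler n (D g) * A k).
have hc : \sum_g prod_weight g * (c g * (expR (z k (g k) * l k) - 1)) <= 0.
  apply: sum_prod_weight_le0 (fun b => expR (z k b * l k) - 1) _ _ _.
  - move=> g; apply: mulr_ge0; first by rewrite invr_ge0 ltW.
    exact: mxtrace_euler_proj_ge0 (l_gt0 k) (A_sym k) (A_sqr k) (sD g) m0.
  - by move=> g; rewrite /c Dflip.
  - under eq_bigr do rewrite mulrBr mulr1.
    by rewrite sumrB w_sum1 subr_le0.
apply: le_trans (_ : \sum_g (prod_weight g * \tr (euler n (D g))
   + prod_weight g * (c g * (expR (z k (g k) * l k) - 1))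
   + prod_weight g * ((\sum_g E g) / n%:R)) <= _).
  apply: ler_sum => g _; rewrite -!mulrDr ler_wpM2l ?prod_weight_ge0 //.
  rewrite big_cons addrC -/(D g).
  have /(_ m m0) := (hE g).2; rewrite -/n => /(_ _)/le_trans; apply.
    by apply: le_trans Cm; rewrite (le_trans (Ele g)) // lerDr.
  apply: lerD; first by rewrite lerD2l /c le_eqVlt; apply/orP; left;
    apply/eqP; ring.
  by rewrite ler_pM2r ?invr_gt0.
rewrite !big_split /= -[X in _ + X]mulr_suml sum_prod_weight // mul1r.
by rewrite [(C + _) / _]mulrDl; lra.
Qed.

End Product.

(** * Scalar exponential estimates *)

Section Scalar.
Variable R : realType.
Implicit Types x y a b h : R.

Lemma le_of_le_add_div x y c :
  (forall M : R, exists n : R, [/\ M <= n, 0 < n & x <= y + c / n]) -> x <= y.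
Proof.
move=> H; rewrite leNgt; apply/negP => yx.
have [n [Mn n0 xy]] := H (`|c| / (x - y) + 1).
have : c / n < x - y; last by lra.
have d0 : 0 < x - y by rewrite subr_gt0.
rewrite ltr_pdivrMr // mulrC -ltr_pdivrMr //.
apply: lt_le_trans Mn; apply: le_lt_trans (_ : `|c| / (x - y) < _); last by lra.
by rewrite ler_pM2r ?invr_gt0 // ler_norm.
Qed.

Lemma bernoulli_ineq a n : 0 <= a <= 1 -> 1 - n%:R * a <= (1 - a) ^+ n.
Proof.
case/andP=> a0 a1; elim: n => [|n IHn]; first by rewrite expr0 mul0r subr0.
have n0 : 0 <= n%:R :> R by [].
rewrite exprSr -natr1; apply: le_trans (_ : (1 - n%:R * a) * (1 - a) <= _);
  first by nra.
by rewrite ler_wpM2r // subr_ge0.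
Qed.

(** With [y = h / n], one has [expR y * (1 - y) <= 1], hence [expR y * (1 - y ^+ 2) <= 1 + y]; raise
    this to the power [n] and use Bernoulli's inequality. *)
Lemma expn_euler_ge h n : (0 < n)%N -> 0 <= h <= n%:R ->
  expR h * (1 - h ^+ 2 / n%:R) <= (1 + h / n%:R) ^+ n.
Proof.
move=> n0 /andP[h0 hn]; have nR : 0 < n%:R :> R by rewrite ltr0n.
set y := h / n%:R; have y0 : 0 <= y by rewrite divr_ge0.
have y1 : y <= 1 by rewrite ler_pdivrMr // mul1r.
have hy : h = n%:R * y by rewrite mulrC divfK // gt_eqF.
have -> : h ^+ 2 / n%:R = n%:R * y ^+ 2 by rewrite /y; field; rewrite gt_eqF.
apply: le_trans (_ : expR h * (1 - y ^+ 2) ^+ n <= _).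
  rewrite ler_wpM2l ?expR_ge0 //; apply: bernoulli_ineq.
  by rewrite sqr_ge0 expr_le1.
rewrite hy expRM_natl -exprMn lerXn2r ?nnegrE ?addr_ge0 //.
  by rewrite mulr_ge0 ?expR_ge0 // subr_ge0 expr_le1.
have -> : 1 - y ^+ 2 = (1 - y) * (1 + y) by ring.
rewrite mulrA ler_piMl ?addr_ge0 // -[leRHS](expRxMexpNx_1 y) ler_wpM2l
  ?expR_ge0 //.
exact: expR_ge1Dx.
Qed.

Lemma leq_fact_2exp3 n : (2 * 3 ^ n <= n.+2`!)%N.
Proof.
elim: n => // n IHn; rewrite expnS mulnCA factS.
by rewrite leq_mul.
Qed.

(** Since [(i + 2)!] is at least [2 * 3 ^ i], the exponential series from its quadratic term on is
    dominated by [y ^+ 2 / 2] times a geometric series of ratio [b / 3]. *)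
Lemma expR_bernstein y b : `|y| <= b -> b < 3 ->
  expR y <= 1 + y + y ^+ 2 / 2 / (1 - b / 3).
Proof.
move=> yb b3; have b0 : 0 <= b by apply: le_trans yb.
have d0 : 0 < 1 - b / 3 by lra.
apply: limr_le; first exact: is_cvg_series_exp_coeff.
exists 2%N => // -[|[|n]] //= _.
rewrite /series /= big_mkord !big_ord_recl /= /exp_coeff /= !expr0 !expr1
  !divr1 addrA lerD2l.
apply: le_trans (_ : y ^+ 2 / 2 * \sum_(i < n) (b / 3) ^+ i <= _).
  rewrite mulr_sumr; apply: ler_sum => i _.
  rewrite /bump /= !add1n.
  have -> : y ^+ i.+2 / i.+2`!%:R = y ^+ 2 * (y ^+ i / i.+2`!%:R).
    by rewrite mulrA -exprD.
  rewrite -mulrA; apply: ler_wpM2l; first exact: sqr_ge0.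
  rewrite expr_div_n [2^-1 * _]mulrCA -invfM.
  apply: le_trans (_ : b ^+ i / i.+2`!%:R <= _).
    rewrite ler_wpM2r ?invr_ge0 //; apply: le_trans (ler_norm _) _.
    by rewrite normrX lerXn2r ?nnegrE.
  rewrite ler_wpM2l ?exprn_ge0 // lef_pV2 ?posrE ?mulr_gt0 ?exprn_gt0 ?ltr0n
    ?fact_gt0 //.
  by rewrite -natrX -natrM ler_nat leq_fact_2exp3.
rewrite ler_wpM2l ?divr_ge0 ?sqr_ge0 // -[leRHS]mul1r ler_pdivlMr //.
have := subrX1 (b / 3) n;
  have : 0 <= (b / 3) ^+ n by rewrite exprn_ge0 ?divr_ge0.
by set S := \sum_(i < n) _; lra.
Qed.

End Scalar.

(** The mean of [expR (theta * x b)] is at most 1 plus the correction, hence at most its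
    exponential. The bound [L] concerns outcomes of positive weight only: a row kept with
    probability 1 may exceed it at the outcome of weight 0. *)
Lemma bernstein_mgf (R : realType) (w x : bool -> R) (L theta : R) :
  (forall b, 0 <= w b) -> \sum_b w b = 1 -> \sum_b w b * x b = 0 ->
  (forall b, 0 < w b -> `|x b| <= L) -> 0 < theta -> theta * L < 3 ->
  \sum_b w b * expR (theta * x b
     - theta ^+ 2 / 2 / (1 - theta * L / 3) * \sum_b w b * x b ^+ 2) <= 1.
Proof.
move=> w0 w1 wx xL t0 tL; set g := theta ^+ 2 / 2 / _;
  set V := \sum_b w b * x b ^+ 2.
have d0 : 0 < 1 - theta * L / 3 by lra.
under eq_bigr do rewrite expRD mulrA.
rewrite -mulr_suml expRN ler_pdivrMr ?expR_gt0 // mul1r.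
apply: le_trans (expR_ge1Dx _).
apply: le_trans (_ : \sum_b (w b + theta * (w b * x b) + g * (w b * x b ^+ 2))
  <= _).
  apply: ler_sum => b _; have := w0 b; rewrite le_eqVlt => /orP[/eqP<-|wb].
    by rewrite !mul0r !mulr0 !addr0.
  have yL : `|theta * x b| <= theta * L.
    by rewrite normrM gtr0_norm // ler_wpM2l ?(ltW t0) // xL.
  apply: le_trans (ler_wpM2l (ltW wb) (expR_bernstein yL tL)) _.
  rewrite /g le_eqVlt; apply/orP; left; apply/eqP; ring.
by rewrite !big_split /= -!mulr_sumr w1 wx mulr0 addr0.
Qed.

(** * From the trace bound to the Bernstein tail *)

Section Tail.
Variables (R : realType) (I : finType) (s : nat).
Variables (w : I -> bool -> R) (A : I -> 'M[R]_s) (l : I -> R).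
Hypothesis w_ge0 : forall k b, 0 <= w k b.
Hypothesis w_sum1 : forall k, \sum_b w k b = 1.
Hypothesis l_gt0 : forall k, 0 < l k.
Hypothesis A_sym : forall k, (A k)^T = A k.
Hypothesis A_sqr : forall k, A k * A k = l k *: A k.

Lemma trmx_comb (y : I -> R) : (\sum_k y k *: A k)^T = \sum_k y k *: A k.
Proof.
by rewrite linear_sum; apply: eq_bigr => i _; rewrite linearZ /= A_sym.
Qed.

(** Counterpart of bounding the exponential of the largest eigenvalue by the trace of the
    exponential, with a unit vector in place of an eigenvector. *)
Lemma quadform_euler_le (H : 'M[R]_s) (v : 'cV[R]_s) h m : H^T = H ->
  v^T *m v = 1%:M -> 0 <= h -> h <= (v^T *m H *m v) 0 0 -> (0 < m)%N ->
  (1 + h / (2 ^ m)%:R) ^+ (2 ^ m) <= \tr (euler (2 ^ m) H).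
Proof.
move=> sH v1 h0 hv m0; set n := (2 ^ m)%N.
have nR : 0 < n%:R :> R by rewrite ltr0n expn_gt0.
set M := 1 + n%:R^-1 *: H.
have sM : M^T = M by rewrite linearD /= linearZ /= sH trmx1.
have hM : 1 + h / n%:R <= (v^T *m M *m v) 0 0.
  rewrite mulmxDr mulmxDl mulmx1 v1 -scalemxAr -scalemxAl mxE mxE eqxx lerD2l
    mxE.
  by rewrite mulrC ler_wpM2l // invr_ge0 ltW.
apply: le_trans (quadform_exp2_ge m sM _ v1 hM) _.
  by rewrite addr_ge0 // divr_ge0 // ltW.
rewrite /euler -/n -/M; have -> : M ^+ n = M ^+ (2 ^ m.-1) *m M ^+ (2 ^ m.-1).
  by rewrite mulmxE -exprD addnn -mul2n -expnS prednK.
by apply: quadform_le_mxtrace => //; rewrite trmxX sM.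
Qed.

Lemma mxtrace_euler_ge0 (H : 'M[R]_s) m : H^T = H -> (0 < m)%N ->
  0 <= \tr (euler (2 ^ m) H).
Proof.
move=> sH m0; set M := 1 + (2 ^ m)%:R^-1 *: H.
have sM : M^T = M by rewrite linearD /= linearZ /= sH trmx1.
have -> : euler (2 ^ m) H = (M ^+ (2 ^ m.-1))^T *m M ^+ (2 ^ m.-1).
  by rewrite trmxX sM mulmxE -exprD addnn -mul2n -expnS prednK.
exact: mxtrace_tr_mul_ge0.
Qed.

Lemma laplace_tail (z : I -> bool -> R) (Q : pred {ffun I -> bool}) h :
  (forall k, \sum_b w k b * expR (z k b * l k) <= 1) -> 0 <= h ->
  (forall g, Q g -> exists2 v : 'cV[R]_s, v^T *m v = 1%:M &
     h <= (v^T *m (\sum_k z k (g k) *: A k) *m v) 0 0) ->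
  (\sum_(g | Q g) prod_weight w g) * expR h <= s%:R.
Proof.
move=> wz h0 hQ; set p := \sum_(g | Q g) _.
have [C C0 hC] := mean_mxtrace_euler_le w_ge0 w_sum1 l_gt0 A_sym A_sqr wz.
have p0 : 0 <= p by apply: sumr_ge0 => g _; apply: prod_weight_ge0.
(* Markov's inequality is proved up to order 1/n: [C] comes from the trace bound, the other term
   from [expn_euler_ge]. The choice of [m] makes [n] exceed the thresholds [M], [C] and [h]
   together. *)
apply: (@le_of_le_add_div _ _ _ (C + p * expR h * h ^+ 2)) => M.
pose m := (Num.bound (`|M| + C + h)).+1; pose n : R := (2 ^ m)%:R.
have hn : `|M| + C + h <= n.
  apply: le_trans (ltW (archi_boundP _)) _; first by rewrite !addr_ge0.
  by rewrite ler_nat ltnW // (leq_trans _ (ltn_expl _ _)).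
have n0 : 0 < n by rewrite ltr0n expn_gt0.
have M0 := normr_ge0 M; have MM := ler_norm M.
exists n; split=> //; first by lra.
have {}hC : \sum_g prod_weight w g * \tr (euler (2 ^ m) (\sum_k z k (g k) *: A
  k))
      <= s%:R + C / n by apply: hC => //; rewrite -/n; lra.
suff : p * (expR h * (1 - h ^+ 2 / n)) <= s%:R + C / n.
  rewrite mulrBr mulr1 mulrBr lerBlDr => /le_trans; apply.
  by rewrite mulrDl addrA lerD2l !mulrA.
apply: le_trans hC; rewrite mulr_suml [leRHS](bigID Q) /= -[leLHS]addr0.
apply: lerD; last first.
  apply: sumr_ge0 => g _; rewrite mulr_ge0 ?prod_weight_ge0 //.
  by apply: mxtrace_euler_ge0 => //; apply: trmx_comb.
apply: ler_sum => g Qg; rewrite ler_wpM2l ?prod_weight_ge0 //.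
have [v v1 hv] := hQ g Qg.
apply: le_trans (quadform_euler_le (m := m) (trmx_comb _) v1 h0 hv isT).
by apply: expn_euler_ge; rewrite ?expn_gt0 // h0 -/n; lra.
Qed.

Lemma bernstein_tail (x : I -> bool -> R) (L sigma a theta : R)
    (Q : pred {ffun I -> bool}) (g := theta ^+ 2 / 2 / (1 - theta * L / 3)) :
  (forall k, \sum_b w k b * x k b = 0) ->
  (forall k b, 0 < w k b -> `|x k b * l k| <= L) ->
  (forall v : 'cV[R]_s, v^T *m v = 1%:M ->
     (v^T *m (\sum_k ((\sum_b w k b * x k b ^+ 2) * l k) *: A k) *m v) 0 0 <=
       sigma) ->
  (forall r, Q r -> exists2 v : 'cV[R]_s, v^T *m v = 1%:M &
     a <= (v^T *m (\sum_k x k (r k) *: A k) *m v) 0 0) ->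
  0 < theta -> theta * L < 3 -> 0 <= theta * a - g * sigma ->
  (\sum_(r | Q r) prod_weight w r) * expR (theta * a - g * sigma) <= s%:R.
Proof.
move=> wx xL hV hQ t0 tL h0; have g0 : 0 <= g.
  by rewrite divr_ge0 ?divr_ge0 ?sqr_ge0 //; lra.
apply: (laplace_tail (z := fun k b => theta * x k b
          - g * ((\sum_b w k b * x k b ^+ 2) * l k))) => // [k|r Qr].
  (* The scalar bound is applied to [x k b * l k], the eigenvalue of the summand on the range of
     [A k]. Of the factor [l k ^+ 2] in its second moment, one [l k] sits in [z] and the other
     multiplies [z]. *)
  have wxl : \sum_b w k b * (x k b * l k) = 0.
    by under eq_bigr do rewrite mulrA; rewrite -mulr_suml wx mul0r.
  have := bernstein_mgf (w_ge0 k) (w_sum1 k) wxl (xL k) t0 tL.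
  congr (_ <= _); apply: eq_bigr => b _; congr (_ * expR _).
  rewrite -/g (_ : \sum_b _ = (\sum_b w k b * x k b ^+ 2) * l k ^+ 2);
    first by ring.
  by rewrite mulr_suml; apply: eq_bigr => c _; rewrite exprMn mulrA.
have [v v1 hv] := hQ r Qr; exists v => //.
clearbody g; under eq_bigr do rewrite scalerBl -[(theta * _) *: _]scalerA -[(g
  * _) *: _]scalerA.
rewrite sumrB -!scaler_sumr mulmxBr mulmxBl -!scalemxAr -!scalemxAl.
rewrite [leRHS]mxE [X in _ <= X + _]mxE [X in _ <= _ + X]mxE [X in _ <= _ -
  X]mxE.
apply: lerB; first by rewrite ler_wpM2l // ltW.
by rewrite ler_wpM2l // hV.
Qed.

Lemma finite_matrix_bernstein (x : I -> bool -> R) (L sigma eps : R)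
    (Q : pred {ffun I -> bool}) :
  (forall k, \sum_b w k b * x k b = 0) ->
  (forall k b, 0 < w k b -> `|x k b * l k| <= L) ->
  (forall v : 'cV[R]_s, v^T *m v = 1%:M ->
     (v^T *m (\sum_k ((\sum_b w k b * x k b ^+ 2) * l k) *: A k) *m v) 0 0 <=
       sigma) ->
  (forall r, Q r -> forall a, 0 < a < eps ->
     exists2 v : 'cV[R]_s, v^T *m v = 1%:M &
     a <= `|(v^T *m (\sum_k x k (r k) *: A k) *m v) 0 0|) ->
  0 < L -> 0 <= sigma -> 0 < eps ->
  \sum_(r | Q r) prod_weight w r
    <= 2 * s%:R * expR (- ((eps ^+ 2 / 2) / (sigma + L * eps / 3))).
Proof.
move=> wx xL hV hQ L0 sigma0 eps0; set D := sigma + _; set p := \sum_(r | _) _.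
have D0 : 0 < D by rewrite ltr_wpDl // divr_gt0 // mulr_gt0.
have p0 : 0 <= p by apply: sumr_ge0 => r _; apply: prod_weight_ge0.
have tail a : 0 < a < eps -> p * expR (a ^+ 2 / 2 / D) <= 2 * s%:R.
  move=> ha; have /andP[a0 ae] := ha.
  (* Raising sigma by L (eps - a) / 3 keeps the denominator equal to D, and
     makes it legitimate to divide by sigma' even if sigma = 0. *)
  pose sigma' := sigma + L * (eps - a) / 3.
  have s'0 : 0 < sigma' by rewrite ltr_wpDl // divr_gt0 // mulr_gt0 // subr_gt0.
  have DE : D = sigma' + L * a / 3 by rewrite /D /sigma'; field.
  (* Bernstein's choice of the parameter, which turns the exponent into exactly [a ^+ 2 / 2 / D]. *)
  pose theta := a / D; have t0 : 0 < theta by rewrite divr_gt0.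
  have tL : theta * L < 3 by rewrite /theta mulrAC ltr_pdivrMr // DE; lra.
  have tE : 1 - theta * L / 3 = sigma' / D.
    have -> : sigma' = D - L * a / 3 by rewrite DE addrK.
    by rewrite /theta; field; rewrite gt_eqF.
  have gE : theta * a - theta ^+ 2 / 2 / (1 - theta * L / 3) * sigma'
      = a ^+ 2 / 2 / D.
    by rewrite tE /theta; field; rewrite !gt_eqF.
  have g0 : 0 <= a ^+ 2 / 2 / D by rewrite !divr_ge0 ?sqr_ge0 // ltW.
  have hV' (v : 'cV[R]_s) : v^T *m v = 1%:M ->
     (v^T *m (\sum_k ((\sum_b w k b * x k b ^+ 2) * l k) *: A k) *m v) 0 0 <=
       sigma'.
    move=> v1; apply: le_trans (hV v v1) _.
    by rewrite lerDl divr_ge0 // mulr_ge0 ?subr_ge0 ?ltW.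
  pose S (r : {ffun I -> bool}) := \sum_k x k (r k) *: A k.
  (* The signs [e = 1] and [e = -1] treat the two tails; every outcome in [Q] lies in one of the two
     events, whence the factor 2. *)
  pose Q' (e : R) r := `[< exists2 v : 'cV[R]_s, v^T *m v = 1%:M &
     a <= e * (v^T *m S r *m v) 0 0 >].
  have one e : e ^+ 2 = 1 -> (\sum_(r | Q' e r) prod_weight w r)
      * expR (a ^+ 2 / 2 / D) <= s%:R.
    move=> e2; have e1 : `|e| = 1 by apply/eqP;
      rewrite -sqrp_eq1 // real_normK ?e2 // num_real.
    rewrite -gE; apply: (@bernstein_tail (fun k b => e * x k b));
      rewrite ?gE //.
    - by move=> k; under eq_bigr do rewrite mulrCA; rewrite -mulr_sumr wx mulr0.
    - by move=> k b wb; rewrite -mulrA normrM e1 mul1r xL.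
    - move=> v v1; have := hV' v v1; congr ((_ *m _ *m _) _ _ <= _).
      apply: eq_bigr => k _; congr (_ * _ *: _).
      by apply: eq_bigr => b _; rewrite exprMn e2 mul1r.
    - move=> r /asboolP[v v1 hv]; exists v => //.
      apply: le_trans hv _; under eq_bigr do rewrite -scalerA.
      by rewrite -scaler_sumr -scalemxAr -scalemxAl [leRHS]mxE.
  have := lerD (one 1 (expr1n _ _)) (one (-1) (sqrr_sign _ 1%N)).
  rewrite -mulrDl => /(fun h => le_trans _ h).
  rewrite [2 * _]mulr_natl mulr2n; apply; rewrite ler_wpM2r ?expR_ge0 //.
  rewrite /p [in leRHS]big_mkcond [X in _ <= _ + X]big_mkcond -big_split
    big_mkcond /=.
  apply: ler_sum => r _; have W0 := prod_weight_ge0 w_ge0 r.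
  have [Qr|_] := boolP (Q r); last by do 2!case: ifP => _;
    rewrite ?addr0 ?add0r ?addr_ge0.
  have [v v1] := hQ r Qr a ha; rewrite -/(S r) ler_normr => /orP[h|h].
    rewrite ifT; first by rewrite lerDl; case: ifP.
    by apply/asboolP; exists v; rewrite ?mul1r.
  rewrite [X in _ <= _ + X]ifT; first by rewrite lerDr; case: ifP.
  by apply/asboolP; exists v; rewrite ?mulN1r.
rewrite expRN ler_pdivlMr ?expR_gt0 //; set E := expR _; set K := p * E.
have K0 : 0 <= K by rewrite mulr_ge0 ?expR_ge0.
(* Let [a = eps - n^-1] tend to [eps]. Since [a ^+ 2 / 2] is at least [eps ^+ 2 / 2 - eps / n], the
   loss is at most [K * eps / D / n]; the summand [2 / eps] in [n] keeps [a] positive. *)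
apply: (@le_of_le_add_div _ _ _ (K * eps / D)) => M.
pose n := `|M| + 2 / eps; have n0 : 0 < n by rewrite ltr_wpDl // divr_gt0.
exists n; split=> //; first by apply: le_trans (ler_norm M) _;
  rewrite lerDl divr_ge0 // ltW.
have n1 : 0 < n^-1 by rewrite invr_gt0.
have ne : n^-1 < eps.
  rewrite invf_plt ?posrE // /n; apply: (@lt_le_trans _ _ (2 / eps));
    last by rewrite lerDr.
  by rewrite -[ltLHS]mul1r ltr_pM2r ?invr_gt0 //; lra.
have /tail : 0 < eps - n^-1 < eps by rewrite subr_gt0 ne /=; lra.
rewrite -lerBlDr => /(le_trans _); apply.
have -> : K - K * eps / D / n = p * (E * (1 - eps / n / D)).
  by rewrite /K; field; rewrite !gt_eqF.
rewrite ler_wpM2l //.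
apply: le_trans (_ : E * expR (- (eps / n / D)) <= _).
  by rewrite ler_wpM2l ?expR_ge0 // expR_ge1Dx.
rewrite /E -expRD ler_expR -mulrBl ler_pM2r ?invr_gt0 //.
have := sqr_ge0 (n^-1); nra.
Qed.

End Tail.

(** * The spectral norm and quadratic forms *)

Section SpectralNorm.
Variable R : realType.

Lemma l2normE n (v : 'cV[R]_n) : l2norm v ^+ 2 = (v^T *m v) 0 0.
Proof.
rewrite sqr_sqrtr; last by apply: sumr_ge0 => i _; rewrite sqr_ge0.
by rewrite mxE; apply: eq_bigr => i _; rewrite mxE expr2.
Qed.

Lemma l2norm_ge0 n (v : 'cV[R]_n) : 0 <= l2norm v.
Proof. exact: sqrtr_ge0. Qed.

Lemma l2norm_le n (v : 'cV[R]_n) (a : R) : 0 <= a ->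
  (l2norm v <= a) = ((v^T *m v) 0 0 <= a ^+ 2).
Proof. by move=> a0; rewrite -l2normE ler_pXn2r ?nnegrE ?l2norm_ge0. Qed.

(** Boundedness is what makes the [sup] in [specnorm] an upper bound. Vectors of the unit ball have
    coordinates at most 1 in absolute value, so row sums control [A *m x]. *)
Lemma has_ubound_specnorm m n (A : 'M[R]_(m, n)) :
  has_ubound [set l2norm (A *m x) | x in [set x : 'cV[R]_n | l2norm x <= 1]].
Proof.
pose B := \sum_i (\sum_j `|A i j|) ^+ 2.
have B0 : 0 <= B by apply: sumr_ge0 => i _; rewrite sqr_ge0.
exists (Num.sqrt B) => _ [x /= x1 <-];
  rewrite l2norm_le ?sqrtr_ge0 // sqr_sqrtr //.
rewrite mxE; apply: ler_sum => i _; rewrite mxE -expr2 -real_normK ?num_real //.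
rewrite lerXn2r ?nnegrE ?normr_ge0 ?sumr_ge0 // mxE.
apply: le_trans (ler_norm_sum _ _ _) _; apply: ler_sum => j _.
rewrite normrM ler_piMr //; move: x1; rewrite l2norm_le // mxE expr1n => x1.
rewrite -(@ler_pXn2r _ 2) ?nnegrE // expr1n real_normK ?num_real //.
apply: le_trans x1; rewrite (bigD1 j) //= mxE -expr2 lerDl.
by apply: sumr_ge0 => k _; rewrite mxE -expr2 sqr_ge0.
Qed.

Lemma l2norm_mul_le_specnorm m n (A : 'M[R]_(m, n)) x :
  l2norm x <= 1 -> l2norm (A *m x) <= specnorm A.
Proof. by move=> x1; apply: (ub_le_sup (has_ubound_specnorm A)); exists x. Qed.

Lemma specnorm_ge0 m n (A : 'M[R]_(m, n)) : 0 <= specnorm A.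
Proof.
apply: le_trans (l2norm_ge0 _) (l2norm_mul_le_specnorm A (x := 0) _).
by rewrite l2norm_le // mulmx0 mxE expr1n.
Qed.

Lemma quadform_le_specnorm n (A : 'M[R]_n) (v : 'cV[R]_n) :
  v^T *m v = 1%:M -> (v^T *m A *m v) 0 0 <= specnorm A.
Proof.
move=> v1; apply: le_trans (ler_norm _) _;
  apply: le_trans (l2norm_mul_le_specnorm A (x := v) _).
  rewrite -(@ler_pXn2r _ 2) ?nnegrE ?l2norm_ge0 // l2normE real_normK ?num_real
    // -mulmxA.
  exact: sqr_dot_le.
by rewrite l2norm_le // v1 mxE expr1n.
Qed.

Lemma quadform_comb n (A : 'M[R]_n) (x y : 'cV[R]_n) (c : R) : A^T = A ->
  ((c *: x + y)^T *m A *m (c *: x + y)) 0 0 =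
  c ^+ 2 * (x^T *m A *m x) 0 0 + 2 * c * (x^T *m A *m y) 0 0
    + (y^T *m A *m y) 0 0.
Proof.
move=> sA; have e : y^T *m A *m x = x^T *m A *m y.
  by rewrite [LHS]mx11_scalar -tr_scalar_mx -mx11_scalar !trmx_mul trmxK sA
    mulmxA.
rewrite [(_ + _)^T]linearD /= linearZ /= !mulmxDl !mulmxDr -!scalemxAl
  -!scalemxAr e scalerA.
move: (_ *m y) (_ *m y) (_ *m x) => m1 m2 m3.
by rewrite !mxE; ring.
Qed.

(** Otherwise [q] is bounded by [a * N] in absolute value everywhere. With [y = A *m x],
    polarization at [a *: x + y] and [- a *: x + y] bounds [4 * a * N y] by
    [a * (2 * a ^+ 2 * N x + 2 * N y)], so [N y <= a ^+ 2] on the unit ball, contradicting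
    [a < specnorm A]. *)
Lemma quadform_ge_specnorm n (A : 'M[R]_n) (a : R) : A^T = A ->
  0 < a -> a < specnorm A ->
  exists2 v : 'cV[R]_n, v^T *m v = 1%:M & a <= `|(v^T *m A *m v) 0 0|.
Proof.
move=> sA a0 aA; apply: contrapT => H.
pose q (v : 'cV[R]_n) := (v^T *m A *m v) 0 0;
  pose N (v : 'cV[R]_n) := (v^T *m v) 0 0.
have N0 v : 0 <= N v by rewrite /N -l2normE sqr_ge0.
have qN v : `|q v| <= a * N v.
  have [Nv|Nv] := eqVneq (N v) 0.
    have -> : v = 0.
      apply/colP => i; rewrite mxE; apply/eqP; rewrite -sqrf_eq0; apply/eqP.
      have /psumr_eq0P : forall i : 'I_n, true -> 0 <= v i 0 ^+ 2 by move=> *;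
        apply: sqr_ge0.
      apply => //; rewrite -[RHS]Nv /N mxE; apply: eq_bigr => j _;
        by rewrite mxE expr2.
    by rewrite /q /N !mulmx0 !mxE normr0 mulr0.
  have Np : 0 < N v by rewrite lt_neqAle eq_sym Nv N0.
  rewrite leNgt; apply/negP => h; apply: H; exists ((Num.sqrt (N v))^-1 *: v).
    rewrite [(_ *: v)^T]linearZ /= -scalemxAl -scalemxAr scalerA -expr2 exprVn
      sqr_sqrtr ?N0 //.
    by rewrite [v^T *m v]mx11_scalar -/(N v) scale_scalar_mx mulVf.
  rewrite [(_ *: v)^T]linearZ /= -!scalemxAl -scalemxAr scalerA -expr2 exprVn
    sqr_sqrtr ?N0 // mxE -/(q v).
  by rewrite normrM gtr0_norm ?invr_gt0 // mulrC ler_pdivlMr // ltW.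
have [|_ [x /= x1 <-]] := sup_gt _ aA;
  first by exists (l2norm (A *m 0)), 0 => //=; rewrite l2norm_le // mulmx0 mxE.
apply/negP; rewrite -leNgt l2norm_le ?(ltW a0) //; move: x1;
  rewrite l2norm_le // expr1n => x1.
set y := A *m x; rewrite -/(N x) in x1; rewrite -/(N y).
have e1 : q (a *: x + y) - q (- a *: x + y) = 4 * a * N y.
  rewrite /q !quadform_comb // (_ : x^T *m A = y^T); first by rewrite -/(N y);
    ring.
  by rewrite trmx_mul sA.
have e2 : N (a *: x + y) + N (- a *: x + y) = 2 * a ^+ 2 * N x + 2 * N y.
  have NE v : N v = (v^T *m 1%:M *m v) 0 0 by rewrite mulmx1.
  by rewrite !NE !quadform_comb ?trmx1 //; ring.
have := qN (a *: x + y); have := qN (- a *: x + y).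
rewrite !ler_norml => /andP[h1 _] /andP[_ h2].
have h3 : 4 * a * N y <= a * (2 * a ^+ 2 * N x + 2 * N y) by rewrite -e1 -e2;
  lra.
have h4 : 2 * N y <= a ^+ 2 * N x + N y.
  by rewrite -(ler_pM2l (_ : 0 < 2 * a)); nra.
have : a ^+ 2 * N x <= a ^+ 2 by rewrite ler_piMr ?sqr_ge0.
lra.
Qed.

End SpectralNorm.

(** * Reduction to a finite product of two-point laws *)

Section IndependentBool.
Variables (R : realType) (d : measure_display) (T : measurableType d).
Variables (Pr : probability T R) (I : finType) (X : I -> {RV Pr >-> bool}).

Lemma measurable_preimage_bool k (b : bool) : measurable (X k @^-1` [set b]).
Proof. by rewrite -[_ @^-1` _]setTI; apply: measurable_funPT. Qed.

(** The event is the finite union of the sets [F g] that fix every trial; independence gives the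
    weight of each, and subadditivity sums them. *)
Lemma probability_indep_le (w : I -> bool -> R) (Q : pred {ffun I -> bool}) :
  mutually_independent X ->
  (forall k b, Pr (X k @^-1` [set b]) = (w k b)%:E) ->
  (Pr [set t | Q [ffun k => X k t]] <= (\sum_(g | Q g) prod_weight w g)%:E)%E.
Proof.
move=> indep wE.
pose F (g : {ffun I -> bool}) := \bigcap_(k in [set` [set: I]%SET]) (X k @^-1`
  [set g k]).
have mF g : measurable (F g).
  by apply: fin_bigcap_measurable => // k _; apply: measurable_preimage_bool.
have PF g : Pr (F g) = (prod_weight w g)%:E.
  rewrite /F (indep _ (fun k => [set g k])) //.
  under eq_bigr do rewrite wE.
  by rewrite prodEFin /prod_weight; congr (_%:E); apply: eq_bigl => k;
    rewrite inE.
have -> : [set t | Q [ffun k => X k t]] = \big[setU/set0]_(g | Q g) F g.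
  rewrite -(bigcup_pred Q); apply/seteqP; split=> t /=.
    by move=> Qt; exists [ffun k => X k t] => // k _ /=; rewrite ffunE.
  move=> [g Qg Fg]; suff -> : [ffun k => X k t] = g by [].
  by apply/ffunP => k; rewrite ffunE; apply: (Fg k); rewrite /= inE.
rewrite -sumEFin; under [leRHS]eq_bigr do rewrite -PF.
suff [] : measurable (\big[setU/set0]_(g | Q g) F g) /\
    (Pr (\big[setU/set0]_(g | Q g) F g) <= \sum_(g | Q g) Pr (F g))%E by [].
apply: (big_rec2 (fun U e => measurable U /\ (Pr U <= e)%E)).
  by split; rewrite ?measure0.
move=> g U e _ [mU Ue]; split; first exact: measurableU.
exact: le_trans (measureU2 _ (mF g) mU) (leeD2l _ Ue).
Qed.

End IndependentBool.

(** * The deviation as a sum of rank-one terms *)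

Section SketchDecomposition.
Variables (R : realType) (N s : nat) (U : 'M[R]_(N, s)) (P : 'M[R]_N) (c : nat).

Lemma mulmx_tr_diag (r : 'rV[R]_N) :
  U^T *m diag_mx r *m U = \sum_i r 0 i *: ((row i U)^T *m row i U).
Proof.
apply/matrixP => j k; rewrite mul_mx_diag !mxE summxE; apply: eq_bigr => i _.
by rewrite !mxE big_ord1 !mxE mulrAC mulrC.
Qed.

Lemma leverageE i : row i U *m (row i U)^T = (leverage U i)%:M.
Proof. by rewrite [LHS]mx11_scalar /leverage l2normE trmxK. Qed.

Lemma row_gram_sqr i : let A : 'M[R]_s := (row i U)^T *m row i U in
  A * A = leverage U i *: A.
Proof.
by rewrite /= -!mulmxE mulmxA -[_ *m (row i U)^T]mulmxA leverageE mul_mx_scalar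
  scalemxAl.
Qed.

Hypothesis P_diag : is_diag_mx P.
Hypothesis P_gt0 : forall i, 0 < P i i.
Hypothesis keep_gt0 : forall i, 0 < keep_prob c U i.

(** The diagonal factors commute and each occurs twice, which removes the square roots; an indicator
    equals its square. *)
Lemma sketchE (h : 'I_N -> bool) : sketch c U P h =
  \sum_i (P i i * ((h i)%:R / keep_prob c U i)) *: ((row i U)^T *m row i U).
Proof.
rewrite /sketch /diag_sqrt /sampling_mx tr_diag_mx -!mulmxA 2!(mulmxA (diag_mx
  _)).
rewrite !mulmx_diag (mulmxA (diag_mx _)) mulmx_diag mulmxA mulmx_tr_diag;
  apply: eq_bigr => i _; rewrite !mxE; congr (_ *: _).
have [p0 k0] := (P_gt0 i, keep_gt0 i).
rewrite -{3}(sqr_sqrtr (ltW p0)) -{3}(sqr_sqrtr (ltW k0)).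
have k0' : Num.sqrt (keep_prob c U i) != 0 by rewrite gt_eqF // sqrtr_gt0.
by case: (h i); rewrite ?mul0r ?mulr0 ?mul0r //=; field.
Qed.

(** Indexing by pairs makes the trials of all sketches a single family; [Ymx U P] is spread over the
    [nu] sketches so that each coefficient is centered. *)
Lemma avg_sketch_subE nu (h : 'I_nu * 'I_N -> bool) : (0 < nu)%N ->
  avg_sketch c U P (fun t i => h (t, i)) - Ymx U P =
  \sum_k (nu%:R^-1 * P k.2 k.2 * ((h k)%:R / keep_prob c U k.2 - 1))
    *: ((row k.2 U)^T *m row k.2 U).
Proof.
move=> nu0; have /diag_mxP[r Pr] := P_diag.
have YE : Ymx U P = \sum_i P i i *: ((row i U)^T *m row i U).
  by rewrite /Ymx Pr mulmx_tr_diag; apply: eq_bigr => i _; rewrite mxE eqxx.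
have -> : Ymx U P = nu%:R^-1 *: \sum_(t < nu) Ymx U P.
  by rewrite sumr_const card_ord -(scaler_nat nu (Ymx U P)) scalerA mulVf
    ?scale1r // pnatr_eq0 -lt0n.
pose F t i := (nu%:R^-1 * P i i * ((h (t, i))%:R / keep_prob c U i - 1))
    *: ((row i U)^T *m row i U).
rewrite [RHS](eq_bigr (fun k => F k.1 k.2)) => [|[]//];
  rewrite -(pair_bigA _ F).
rewrite /avg_sketch -scalerBr -sumrB scaler_sumr.
apply: eq_bigr => t _; rewrite sketchE YE -sumrB scaler_sumr.
apply: eq_bigr => i _; rewrite -scalerBl scalerA; congr (_ *: _); ring.
Qed.

End SketchDecomposition.

Theorem theorem5p6 (R : realType) (d : measure_display) (T : measurableType d)
    (Pr : probability T R) (N s c nu : nat)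
    (U : 'M[R]_(N, s)) (P : 'M[R]_N)
    (gamma : 'I_nu -> 'I_N -> {RV Pr >-> bool}) (eps : R)
    (hNs : (s < N)%N) (hc : (0 < c)%N) (hnu : (0 < nu)%N)
    (hPdiag : is_diag_mx P) (hPpos : forall i : 'I_N, 0 < P i i)
    (hU : U^T *m U = 1%:M)
    (heta : forall i : 'I_N, 0 < keep_prob c U i)
    (hgamma : forall (t : 'I_nu) (i : 'I_N),
        distribution Pr (gamma t i) =1 bernoulli_prob (keep_prob c U i))
    (hindep : mutually_independent
        (fun k : 'I_nu * 'I_N => gamma k.1 k.2))
    (heps0 : 0 < eps) (heps1 : eps < 1) :
  (Pr [set w : T | (eps <=
         specnorm (avg_sketch c U P (fun t i => gamma t i w) - Ymx U P))%R]
   <= (2 * s%:R * expR (- ((eps ^+ 2 / 2)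
                           / (varnorm c U P nu + Lconst s c P * eps / 3))))%:E)%E.
Proof.
have i0 : 'I_N by apply: Ordinal (leq_ltn_trans (leq0n s) hNs).
have lev0 i : 0 < leverage U i.
  rewrite lt_neqAle sqr_ge0 andbT eq_sym; apply/eqP => l0.
  by have := heta i; rewrite /keep_prob /lev_prob l0 !mulr0 lt_min ltxx andbF.
(* If [s] were 0, the convention that [0^-1] is 0 would make every keep probability 0. *)
have s0 : 0 < s%:R :> R.
  rewrite lt_neqAle ler0n andbT eq_sym; apply/eqP => s0.
  by have := heta i0; rewrite /keep_prob /lev_prob s0 invr0 mul0r mulr0 lt_min
    ltxx andbF.
have c0 : 0 < c%:R :> R by rewrite ltr0n.
have nu0 : 0 < nu%:R :> R by rewrite ltr0n.
pose eta i := keep_prob c U i.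
have eta1 i : eta i <= 1 by rewrite /eta /keep_prob ge_min lexx.
pose w (k : 'I_nu * 'I_N) (b : bool) : R := if b then eta k.2 else 1 - eta k.2.
pose x (k : 'I_nu * 'I_N) (b : bool) : R := nu%:R^-1 * P k.2 k.2 * (b%:R / eta
  k.2 - 1).
pose A (k : 'I_nu * 'I_N) : 'M[R]_s := (row k.2 U)^T *m row k.2 U.
pose l (k : 'I_nu * 'I_N) := leverage U k.2.
pose Q (r : {ffun 'I_nu * 'I_N -> bool}) :=
  eps <= specnorm (avg_sketch c U P (fun t i => r (t, i)) - Ymx U P).
have wE k b : Pr (gamma k.1 k.2 @^-1` [set b]) = (w k b)%:E.
  have := hgamma k.1 k.2 [set b]; rewrite /distribution /pushforward => ->.
  rewrite bernoulli_probE ?eta1 ?andbT ?(ltW (heta _)) // /w !diracE.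
  have mE (u v : bool) : (u \in [set v]) = (u == v).
    by apply/idP/eqP => [/set_mem|->] //; apply/mem_set.
  by rewrite !mE; case: b => /=; rewrite ?mule1 ?mule0 ?adde0 ?add0e.
have gammaE t : (fun u i => [ffun k => gamma k.1 k.2 t] (u, i)) =
    (fun u i => gamma u i t).
  by apply/funext => u; apply/funext => i; rewrite ffunE.
have -> : [set t | eps <= specnorm
      (avg_sketch c U P (fun u i => gamma u i t) - Ymx U P)]
    = [set t | Q [ffun k => gamma k.1 k.2 t]].
  by apply/funext => t; rewrite /mkset /Q gammaE.
apply: le_trans (probability_indep_le Q hindep wE) _; rewrite lee_fin.
have Asym k : (A k)^T = A k by rewrite /A trmx_mul trmxK.
have Pmax i : P i i <= max_diag P.
  exact: (le_bigmax _ (fun j => P j j)).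
have L0 : 0 < Lconst s c P.
  by rewrite mulr_gt0 ?divr_gt0 // (lt_le_trans (hPpos i0)).
apply: (@finite_matrix_bernstein _ _ _ w A l _ _ _ _ _ x).
- by move=> k b; rewrite /w; case: b; rewrite ?subr_ge0 // ltW.
- by move=> k; rewrite big_bool /w /=; ring.
- by move=> k; apply: lev0.
- exact: Asym.
- by move=> k; apply: row_gram_sqr.
- move=> k; rewrite big_bool /w /x /=; field.
  by rewrite !gt_eqF.
- move=> k b wb; rewrite /l /x.
  have e0 := heta k.2; rewrite -/(eta k.2) in e0.
  have [p0 l0] := (hPpos k.2, lev0 k.2).
  rewrite -!mulrA normrM gtr0_norm ?invr_gt0 // normrM gtr0_norm //.
  (* [Lconst] carries no factor [nu%:R^-1], so that factor is bounded by 1. *)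
  have nu1 : nu%:R^-1 <= 1 :> R by rewrite invf_le1 // ler1n.
  apply: le_trans (ler_piMl _ nu1) _.
    by rewrite mulr_ge0 // ltW.
  rewrite /Lconst mulrC; apply: ler_pM => //; first exact: ltW.
  have sc0 : 0 <= s%:R / c%:R :> R by rewrite divr_ge0.
  move: wb e0 => /=; rewrite /w /eta /keep_prob /lev_prob.
  (* If the minimum is 1, the only outcome of positive weight is [true], where [x] vanishes.
     Otherwise the leverage is [s%:R / c%:R] times the keep probability, which cancels the division
     by [eta]. *)
  have [_|lt1] := leP 1 (c%:R * (s%:R^-1 * leverage U k.2)).
    by case: b; rewrite ?subrr ?ltxx // invr1 mul1r subrr mul0r normr0.
  move=> _ e0; set e := c%:R * _ in e0 lt1 *.
  have lE : leverage U k.2 = s%:R / c%:R * e by rewrite /e; field;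
    rewrite !gt_eqF.
  rewrite lE mulrCA normrM (ger0_norm sc0) ler_piMr //.
  case: b; last by rewrite /= mul0r sub0r mulN1r normrN gtr0_norm // ltW.
  rewrite mulrBl divfK ?gt_eqF // mul1r -[true%:R]/(1 : R).
  by rewrite ger0_norm; lra.
- move=> v v1.
  pose F i := (P i i ^+ 2 * ((eta i)^-1 - 1) * leverage U i) *: ((row i U)^T *m
    row i U).
  (* The second moment of each coefficient has a factor [nu%:R^-1] squared; summing over the [nu]
     sketches cancels one of the two. *)
  rewrite (eq_bigr (fun k => nu%:R^-1 *: (nu%:R^-1 *: F k.2))); last first.
    move=> k _; rewrite /F !scalerA; congr (_ *: _);
      rewrite big_bool /w /x /l /=.
    by field; rewrite !gt_eqF //; apply: heta.
  rewrite -(pair_bigA _ (fun _ i => nu%:R^-1 *: (nu%:R^-1 *: F i))) /=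
    sumr_const card_ord.
  rewrite -scaler_sumr -scaler_nat scalerA mulfV ?gt_eqF // scale1r
    -scaler_sumr.
  rewrite -scalemxAr -scalemxAl mxE /varnorm.
  apply: ler_wpM2l; first by rewrite invr_ge0 ltW.
  exact: quadform_le_specnorm.
- move=> r Qr a /andP[a0 ae]; apply: quadform_ge_specnorm => //.
    exact: (trmx_comb Asym (fun k => x k (r k))).
  apply: lt_le_trans ae _; move: Qr; rewrite /Q.
  by rewrite (avg_sketch_subE hPdiag hPpos heta r hnu).
- exact: L0.
- by rewrite mulr_ge0 ?invr_ge0 ?specnorm_ge0 // ltW.
- exact: heps0.
Qed.
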